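(* Suppose $X=(x_1,\dots,x_n)$ is an $n$-frame in $V(\mathbb R)$ with $U:=\mathrm{span}(X)=\mathrm{span}\{u_0,w_1,\dots,w_{n-1}\}$. Then $$\varphi_n(Z(t,b',b''),X)=2^{n/2}\,\tfrac12\det g(X)\;e^{-\pi\,\mathrm{tr}(X,X)_{Z(t,b',0)}}\;t^{-n-1}\,dt\wedge db_1\wedge\dots\wedge db_{n-1},$$ where $g(X)$ is the matrix expressing the basis $X$ for $U$ in terms of the basis $\{u_0,w_1,\dots,w_{n-1}\}$ for $U$, i.e. $(x_1,\dots,x_n)=(u_0,w_1,\dots,w_{n-1})\,g(X)$.
   Context: $V$ is a $\mathbb Q$-vector space of dimension $p+1$ with an orientation and a symmetric bilinear form $(\,,)$ of signature $(p,1)$, and $1\le n\le p$. A Witt basis of $V$ is a positively oriented basis $u_0,w_1,\dots,w_{p-1},u_0'$ with $u_0,u_0'$ isotropic, $(u_0,u_0')=-\frac12$, and $w_1,\dots,w_{p-1}$ a basis of the positive definite space $W=\{u_0,u_0'\}^\perp$. Let $B$ be the component of $\{Z\in V(\mathbb R):(Z,Z)=-1\}$ containing $Z_0=u_0+u_0'$, with $T_Z(B)=Z^\perp$. For $t>0$ and $b\in W(\mathbb R)$ put $Z(t,b)=(t+t^{-1}(b,b))u_0+t^{-1}b+t^{-1}u_0'\in B$. Let $U'=U\cap W=\mathrm{span}\{w_1,\dots,w_{n-1}\}$ and let $U''$ be the orthogonal complement of $U'$ in $W$. Identify $W(\mathbb R)$ with $\mathbb R^{p-1}$, $b=(b_1,\dots,b_{p-1})$,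 compatibly with $W=U'\oplus U''$: $b=(b',b'')$ with $b'=(b_1,\dots,b_{n-1})\in U'$ and $b''=(b_n,\dots,b_{p-1})\in U''$, and $Z(t,b',b'')=Z(t,b)$. The coordinates $b_i$ are those with respect to vectors $e_2,\dots,e_p$ of $W(\mathbb R)$ (that is, $b=\sum_i b_ie_{i+1}$) which together with $e_1=u_0-u_0'$ form an orthonormal basis $e_1,\dots,e_p$ of $Z_0^\perp$. For $Z\in B$, $(\,,)_Z$ is the positive definite form equal to $(\,,)$ on $Z^\perp$ and $-(\,,)$ on $\mathbb RZ$ (with $Z^\perp$ and $\mathbb RZ$ orthogonal), and $(X,X)_Z=((x_i,x_j)_Z)$. $\varphi_n(Z,X)$ is the $n$-form on $B$ with $\varphi_n(Z,X)(\xi_1,\dots,\xi_n)=2^{n/2}\det((x_i,\xi_j))\,e^{-\pi\,\mathrm{tr}(X,X)_Z}$ for $\xi_j\in T_Z(B)$.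
   Formalization: The printed formula fails for a general Witt basis (replacing w_1 by 2w_1 halves det g(X) but keeps the left side); proved with the extra factor c = det((w_i, e_{j+1})), i,j ≤ n-1, on the right, and as printed when c = 1, which is exactly when it holds. *)

(* Defs.v *)
From HB Require Import structures.
From mathcomp Require Import all_boot all_order all_algebra.
From mathcomp Require Import all_classical all_reals all_analysis.
From mathcomp Require Import ring.

Set Implicit Arguments.
Unset Strict Implicit.
Unset Printing Implicit Defensive.

Import Order.TTheory GRing.Theory Num.Theory.
Import VectorInternalTheory.
Import numFieldNormedType.Exports.

Local Open Scope classical_set_scope.
Local Open Scope ring_scope.

(* V(R) is modelled on coordinates: the row vector of a rational vector in the
   canonical basis of V, with entries in R. *)
Notation realification R V := 'rV[R]_(dim V).

Section Realification.
Variables (R : realType) (V : vectType rat).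

Definition toR (v : V) : realification R V := map_mx ratr (v2r v).

Variable B : {symmetric V}.

Definition gram : 'M[rat]_(dim V) :=
  \matrix_(i, j) B (r2v (delta_mx 0 i)) (r2v (delta_mx 0 j)).

Definition realform : realification R V -> realification R V -> R :=
  form idfun (map_mx ratr gram).

Let realform_bilinear :
  bilinear_for (GRing.Scale.Law.clone _ _ *%R _)
    (GRing.Scale.Law.clone _ _ (idfun \; *%R) _) realform.
Proof.
split=> [v a x y|u a x y]; rewrite /realform.
  by rewrite formDl formZl.
by rewrite formDr formZr.
Qed.

HB.instance Definition _ :=
  bilinear_isBilinear.Build R (realification R V) (realification R V) R _ _
    realform realform_bilinear.

Let gram_sym : (map_mx (ratr : rat -> R) gram)^T = map_mx ratr gram.
Proof.
by apply/matrixP=> i j; rewrite !mxE; congr ratr; rewrite hermC expr0 mul1r.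
Qed.

Let realform_sym x y : realform x y = (-1) ^+ false * idfun (realform y x).
Proof.
rewrite expr0 mul1r /= /realform /form !map_mx_id //.
set M := map_mx _ gram.
transitivity ((x *m M *m y^T)^T 0 0); first by rewrite [RHS]mxE.
by rewrite !trmx_mul trmxK gram_sym mulmxA.
Qed.

HB.instance Definition _ :=
  isHermitianSesquilinear.Build R (realification R V) false idfun
    realform realform_sym.

Lemma realform_toR u v : realform (toR u) (toR v) = ratr (B u v).
Proof.
have sumE x : x = \sum_i v2r x 0 i *: r2v (delta_mx 0 i) :> V.
  rewrite -{1}[x]v2rK {1}[v2r x]row_sum_delta linear_sum /=.
  by apply: eq_bigr => i _; rewrite linearZ.
rewrite {2}[u]sumE {2}[v]sumE linear_sumr /= rmorph_sum /realform /form !mxE.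
apply: eq_bigr => j _; rewrite linear_sumlz rmorph_sum !mxE mulr_suml.
apply: eq_bigr => i _; rewrite !mxE [in RHS]linearZl_LR [in RHS]linearZ_LR /= !rmorphM /=.
ring.
Qed.

End Realification.

Arguments toR R {V} v.
Arguments realform R {V} B.

(* Signature (p, q): an orthogonal basis with p squares 1 followed by
   q squares -1. *)
Definition has_signature (R : realFieldType) (E : vectType R)
    (f : {symmetric E}) (p q : nat) : Prop :=
  exists e : (p + q).-tuple E, basis_of fullv e /\
    forall i j : 'I_(p + q),
      f e`_i e`_j = (-1) ^+ (p <= i)%N *+ (i == j).

(* An orientation is given by an ordered basis o representing it. *)
Definition positively_oriented (V : vectType rat) (m : nat)
    (o : m.-tuple V) (s : seq V) : Prop :=
  0 < \det (\matrix_(i < m, j < m) coord o i s`_j).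

Record Witt_basis (V : vectType rat) (B : {symmetric V}) (m : nat)
    (o : m.-tuple V) (u0 : V) (w : seq V) (u0' : V) : Prop := {
  Witt_basisP : basis_of fullv (u0 :: rcons w u0');
  Witt_oriented : positively_oriented o (u0 :: rcons w u0');
  Witt_isotropic : B u0 u0 = 0;
  Witt_isotropic' : B u0' u0' = 0;
  Witt_pairing : B u0 u0' = - (2%:R)^-1;
  Witt_perp : basis_of (orthov B <<[:: u0; u0']>>%VS) w;
  Witt_posdef : {in orthov B <<[:: u0; u0']>>%VS,
                   forall v, v != 0 -> 0 < B v v} }.

Section Hyperbolic.
Variables (R : realType) (d : nat).
Let E := 'rV[R]_d.
Variable f : {symmetric E}.

Definition hyperboloid (Z0 : E) : set E :=
  connected_component [set Z : E | f Z Z = -1] Z0.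

Definition tangent (Z : E) : {vspace E} := orthov f <[Z]>%VS.

Definition line_part (Z x : E) : E := (f x Z / f Z Z) *: Z.
Definition perp_part (Z x : E) : E := x - line_part Z x.

Definition majorant (Z x y : E) : R :=
  f (perp_part Z x) (perp_part Z y) - f (line_part Z x) (line_part Z y).

(* The form lives on the hyperboloid: phi is given the junk value 0 when Z is
   off the hyperboloid or when some xi j is not tangent at Z. *)
Definition phi (Z0 : E) (n : nat) (X : n.-tuple E) (Z : E)
    (xi : 'I_n -> E) : R :=
  if `[< hyperboloid Z0 Z /\ forall j, xi j \in tangent Z >] then
    2 `^ (n%:R / 2) * \det (\matrix_(i < n, j < n) f X`_i (xi j))
    * expR (- pi * \tr (\matrix_(i < n, j < n) majorant Z X`_i X`_j))
  else 0.

Definition horo (u0 u0' : E) (t : R) (b : E) : E :=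
  (t + t^-1 * f b b) *: u0 + t^-1 *: b + t^-1 *: u0'.

End Hyperbolic.

(* b = \sum_i b_i e_{i+1}; as e is indexed from 0, e_{i+1} for the 1-based
   index i is e`_i.+1 for the 0-based one. *)
Definition from_coord (R : realType) (d m : nat) (e : seq 'rV[R]_d)
    (b : 'rV[R]_m) : 'rV[R]_d := \sum_(i < m) b 0 i *: e`_i.+1.

(* (b', 0), for b' made of the first n - 1 coordinates of b *)
Definition trunc_coord (R : realType) (n m : nat) (b : 'rV[R]_m) : 'rV[R]_m :=
  \row_(i < m) (if (i < n.-1)%N then b 0 i else 0).

Definition pullback (R : realType) (E F : normedModType R) (n : nat)
    (h : E -> F) (omega : F -> ('I_n -> F) -> R) (a : E) (eta : 'I_n -> E) : R :=
  omega (h a) (fun j => 'd h a (eta j)).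

(* The covectors dt, db_1, db_2, ... on R x R^m, numbered from 0. *)
Definition dcoord (R : realType) (m i : nat) (eta : R * 'rV[R]_m) : R :=
  (eta.1 :: [seq eta.2 0 j | j <- enum 'I_m])`_i.

Definition wedge (R : realType) (E : Type) (n : nat)
    (alpha : 'I_n -> E -> R) (eta : 'I_n -> E) : R :=
  \det (\matrix_(i < n, j < n) alpha i (eta j)).

(* Main.v *)
(* Every x in U is a combination of u = u_0 and of vectors of W. The derivative
   of Z(t, b) along (tau, beta) pairs with u to tau / (2 t^2), and with x in W
   to (x, beta) / t - tau (x, b) / t^2. So the matrix ((x_i, xi_j)) factors as
   g^T N D, where D is the matrix of dt, db_1, ..., db_(n-1) on the given
   vectors (w_k is orthogonal to e_(i+1) for i >= n) and N is block lower
   triangular, with diagonal blocks 1/(2 t^2) and C/t, C being the matrix of the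
   (w_k, e_(l+1)). On the hyperboloid (x, y)_Z = (x, y) + 2 (x, Z) (y, Z), and
   (x, Z(t, b)) for x in U does not involve b''. *)

Require Import Defs.
From HB Require Import structures.
From mathcomp Require Import all_boot all_order all_algebra.
From mathcomp Require Import all_classical all_reals all_analysis.
From mathcomp Require Import ring.

Set Implicit Arguments.
Unset Strict Implicit.
Unset Printing Implicit Defensive.

Import Order.TTheory GRing.Theory Num.Theory.
Import numFieldNormedType.Exports.

Local Open Scope classical_set_scope.
Local Open Scope ring_scope.

Section Horospherical.
Variables (R : realType) (d : nat) (f : {symmetric 'rV[R]_d}).

Lemma symC x y : f x y = f y x.
Proof. by rewrite hermC expr0 mul1r. Qed.

Lemma symDl x y z : f (x + y) z = f x z + f y z.
Proof. exact: linearDl. Qed.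

Lemma symDr x y z : f z (x + y) = f z x + f z y.
Proof. exact: linearDr. Qed.

Lemma sym_sumr I (r : seq I) (P : pred I) (x : I -> 'rV[R]_d) z :
  f z (\sum_(i <- r | P i) x i) = \sum_(i <- r | P i) f z (x i).
Proof. exact: linear_sumr. Qed.

Lemma symNl x z : f (- x) z = - f x z.
Proof. exact: linearNl. Qed.

Lemma symNr x z : f z (- x) = - f z x.
Proof. exact: linearNr. Qed.

Lemma symZl (a : R) x y : f (a *: x) y = a * f x y.
Proof. exact: linearZl_LR. Qed.

Lemma symZr (a : R) x y : f x (a *: y) = a * f x y.
Proof. exact: linearZr_LR. Qed.

Lemma orthonormal_nth (s : seq 'rV[R]_d) i j :
  orthonormal f s -> (i < size s)%N -> (j < size s)%N ->
  f s`_i s`_j = (i == j)%:R.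
Proof.
case/andP; elim: s i j => [//|x s IH] i j /= /andP[/eqP xx s1].
rewrite andbT => /andP[/allP /= xs s2].
case: i j => [|i] [|j] //=; rewrite ?ltnS ?eqSS.
- by move=> _ js; apply/eqP/xs/mem_nth.
- by move=> iS _; rewrite symC; apply/eqP/xs/mem_nth.
- exact: IH.
Qed.

Variables u u' : 'rV[R]_d.
Hypothesis fuu : f u u = 0.
Hypothesis fu'u' : f u' u' = 0.
Hypothesis fuu' : f u u' = - 2^-1.

Lemma horo_norm t b : t != 0 -> f u b = 0 -> f u' b = 0 ->
  f (horo f u u' t b) (horo f u u' t b) = -1.
Proof.
move=> t0 ub u'b; rewrite /horo.
rewrite !(symDl, symDr) !(symZl, symZr).
rewrite (symC b u) (symC b u') (symC u' u) fuu fu'u' fuu' ub u'b.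
by field; rewrite t0.
Qed.

Lemma majorantE Z x y : f Z Z = -1 ->
  majorant f Z x y = f x y + 2 * (f x Z * f y Z).
Proof.
move=> ZZ; rewrite /majorant /perp_part /line_part ZZ.
rewrite !(symDl, symDr, symNl, symNr, symZl, symZr).
rewrite (symC Z y) ZZ invrN1; ring.
Qed.

Lemma is_diff_coord m (x : R * 'rV[R]_m) i :
  is_diff x (fun y : R * 'rV[R]_m => y.2 0 i) (fun y => y.2 0 i).
Proof.
pose h (y : R * 'rV[R]_m) := y.2 0 i.
have lh : linear h by move=> a y z; rewrite /h /= !mxE.
pose hM := GRing.isLinear.Build _ _ _ _ _ lh.
pose hL : {linear _ -> _} := HB.pack h hM.
have ch : continuous hL.
  move=> y; apply: (@continuous_comp _ _ _ (@snd R 'rV[R]_m) (fun M => M 0 i)).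
    exact: cvg_snd.
  exact: coord_continuous.
rewrite -/h -[h]/(hL : _ -> _).
apply: DiffDef; first exact: linear_differentiable.
exact: diff_lin.
Qed.

Lemma is_diff_fst m (x : R * 'rV[R]_m) : is_diff x (@fst R 'rV[R]_m) (@fst _ _).
Proof.
have ch : continuous (@fst R 'rV[R]_m) by move=> y; exact: cvg_fst.
apply: DiffDef; first exact: linear_differentiable.
exact: diff_lin.
Qed.

Lemma is_diff_fstV m (x : R * 'rV[R]_m) : x.1 != 0 ->
  is_diff x (fun y : R * 'rV[R]_m => y.1^-1) (fun y => - x.1 ^- 2 * y.1).
Proof.
move=> x0; have df := is_diff_fst x.
apply: DiffDef; first exact: differentiableV.
by rewrite diffV // diff_val.
Qed.

Lemma is_diff_sum_seq (V W : normedModType R) (I : Type) (r : seq I)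
  (h dh : I -> V -> W) (x : V) : (forall i, is_diff x (h i) (dh i)) ->
  is_diff x (fun y => \sum_(i <- r) h i y) (fun y => \sum_(i <- r) dh i y).
Proof.
move=> dhx; elim: r => [|i r IH].
  rewrite (_ : (fun y => _) = cst 0); last by apply/funext=> y; rewrite big_nil.
  rewrite [X in is_diff _ _ X](_ : _ = 0); first exact: is_diff_cst.
  by apply/funext=> y; rewrite big_nil.
rewrite (_ : (fun y => _) = h i + (fun y => \sum_(i <- r) h i y)); last first.
  by apply/funext=> y; rewrite big_cons.
rewrite [X in is_diff _ _ X](_ : _ = dh i + (fun y => \sum_(i <- r) dh i y)).
  exact: is_diffD.
by apply/funext=> y; rewrite big_cons.
Qed.

Lemma is_diff_scale (V W : normedModType R) (k dk : V -> R) (v : W) (x : V) :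
  is_diff x k dk -> is_diff x (fun y => k y *: v) (fun y => dk y *: v).
Proof. by move=> dkx; exact: (is_diff_comp dkx (is_diff_scalel (k x) v)). Qed.

Section Coordinates.
Variables (m : nat) (e : seq 'rV[R]_d).
Hypothesis fe : forall i j : 'I_m, f e`_i.+1 e`_j.+1 = (i == j)%:R.
Hypothesis ue : forall i : 'I_m, f u e`_i.+1 = 0.
Hypothesis u'e : forall i : 'I_m, f u' e`_i.+1 = 0.

Lemma form_from_coordr x (b : 'rV[R]_m) :
  f x (from_coord e b) = \sum_i b 0 i * f x e`_i.+1.
Proof. by rewrite sym_sumr; apply: eq_bigr => i _; rewrite symZr. Qed.

Lemma form_from_coord (a b : 'rV[R]_m) :
  f (from_coord e a) (from_coord e b) = \sum_i a 0 i * b 0 i.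
Proof.
rewrite form_from_coordr; apply: eq_bigr => i _.
rewrite symC form_from_coordr (bigD1 i) //= fe eqxx mulr1 big1 ?addr0.
  by rewrite mulrC.
by move=> j ji; rewrite fe eq_sym (negbTE ji) mulr0.
Qed.

Lemma form_u_from_coord (b : 'rV[R]_m) : f u (from_coord e b) = 0.
Proof. by rewrite form_from_coordr big1 // => i _; rewrite ue mulr0. Qed.

Lemma form_u'_from_coord (b : 'rV[R]_m) : f u' (from_coord e b) = 0.
Proof. by rewrite form_from_coordr big1 // => i _; rewrite u'e mulr0. Qed.

Let Z (x : R * 'rV[R]_m) := horo f u u' x.1 (from_coord e x.2).

Definition dhoro (t : R) (b : 'rV[R]_m) (v : R * 'rV[R]_m) : 'rV[R]_d :=
  let fb := from_coord e b in let fv := from_coord e v.2 in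
  (v.1 - t ^- 2 * v.1 * f fb fb + 2 * t^-1 * f fb fv) *: u
  + (t^-1 *: fv - (t ^- 2 * v.1) *: fb) - (t ^- 2 * v.1) *: u'.

Lemma is_diff_horo (t : R) (b : 'rV[R]_m) :
  t != 0 -> is_diff (t, b) Z (dhoro t b).
Proof.
move=> t0.
pose q (y : R * 'rV[R]_m) : R := \sum_i y.2 0 i * y.2 0 i.
pose dq (y : R * 'rV[R]_m) : R := \sum_i (b 0 i *: y.2 0 i + b 0 i *: y.2 0 i).
have Dq : is_diff (t, b) q dq.
  apply: is_diff_sum_seq => i.
  by have Di := is_diff_coord (t, b) i; exact: (is_diffM Di Di).
have DV : is_diff (t, b) (fun y : R * 'rV[R]_m => y.1^-1) _ :=
  @is_diff_fstV m (t, b) t0.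
have Df := is_diff_fst (t, b).
have D1 := is_diff_scale u (is_diffD Df (is_diffM DV Dq)).
have D2 := is_diff_sum_seq (index_enum 'I_m) (fun i : 'I_m =>
  is_diff_scale e`_i.+1 (is_diffM DV (is_diff_coord (t, b) i))).
have D3 := is_diff_scale u' DV.
have D := is_diffD (is_diffD D1 D2) D3.
rewrite [Z](_ : _ = (fun y => (y.1 + y.1^-1 * q y) *: u) +
   (fun y : R * 'rV[R]_m => \sum_(i < m) (y.1^-1 * y.2 0 i) *: e`_i.+1) +
   (fun y => y.1^-1 *: u')); last first.
  apply/funext => y; rewrite /Z /horo form_from_coord; congr (_ + _ + _).
  by rewrite /from_coord scaler_sumr; apply: eq_bigr => i _; rewrite scalerA.
apply: is_diff_eq.
apply/funext => -[s v]; rewrite /dhoro !form_from_coord.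
congr (_ + _ + _).
- congr (_ *: u).
  transitivity (s + (t^-1 * dq (s, v) + q (t, b) * (- t ^- 2 * s))) => //.
  have -> : dq (s, v) = 2 * \sum_i b 0 i * v 0 i.
    rewrite mulr_sumr; apply: eq_bigr => i _.
    by transitivity (b 0 i * v 0 i + b 0 i * v 0 i) => //; ring.
  by rewrite /q /=; ring.
- rewrite /from_coord !scaler_sumr -sumrB; apply: eq_bigr => i _.
  rewrite !scalerA -scalerBl; congr (_ *: _).
  transitivity (t^-1 * v 0 i + b 0 i * (- t ^- 2) * s) => //.
  by rewrite /=; ring.
- by rewrite -scaleNr mulNr.
Qed.

Lemma tangent_dhoro (t : R) b v :
  t != 0 -> dhoro t b v \in tangent f (Z (t, b)).
Proof.
move=> t0; rewrite /tangent mem_orthov1 /dhoro /Z /horo /=; apply/eqP.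
rewrite !(symDl, symDr, symNl, symNr, symZl, symZr).
rewrite !(symC _ u) !(symC _ u') (symC u' u).
rewrite !form_u_from_coord !form_u'_from_coord.
rewrite fuu fu'u' fuu' (symC (from_coord e v.2)).
by field; rewrite t0.
Qed.

(* Z(1 + s (t - 1), s b), for s in [0, 1], is a path on the hyperboloid. *)
Lemma horo_hyperboloid (t : R) b : 0 < t -> hyperboloid f (u + u') (Z (t, b)).
Proof.
move=> t0.
pose l (s : R) : R := 1 + s * (t - 1).
pose h (s : R) := Z (l s, s *: b).
have l_gt0 s : s \in `[0, 1] -> 0 < l s.
  rewrite in_itv /= => /andP[s0 s1]; rewrite /l.
  have -> : 1 + s * (t - 1) = (1 - s) + s * t by ring.
  have [->|sn0] := eqVneq s 0; first by rewrite mul0r addr0 subr0.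
  by rewrite ltr_wpDl ?subr_ge0 // mulr_gt0 // lt0r sn0.
exists (h @` `[0, 1]); last first.
  exists 1; first by rewrite /= in_itv /= ler01 lexx.
  by rewrite /h /l scale1r mul1r addrC subrK.
split.
- exists 0; first by rewrite /= in_itv /= ler01 lexx.
  rewrite /h /l /Z /horo /= mul0r addr0 invr1 scale0r.
  rewrite form_from_coord big1 ?mulr0 ?addr0; last first.
    by move=> i _; rewrite mxE mul0r.
  rewrite /from_coord big1 ?scaler0 ?addr0 ?scale1r // => i _.
  by rewrite mxE scale0r.
- move=> _ [s s01 <-]; apply: horo_norm.
  + by rewrite gt_eqF // l_gt0.
  + exact: form_u_from_coord.
  + exact: form_u'_from_coord.
apply: connected_continuous_connected; first exact: segment_connected.
apply: continuous_in_subspaceT => s; rewrite inE /= => s01.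
apply: (@continuous_comp _ _ _ (fun s => (l s, s *: b)) Z).
  apply: (@cvg_pair _ _ _ (nbhs s) (nbhs (l s)) (nbhs (s *: b)) _ _ _ l
    (fun s => s *: b)).
    apply: cvgD; first exact: cvg_cst.
    by apply: cvgM; [exact: cvg_id | exact: cvg_cst].
  exact: scalel_continuous.
have ls0 : l s != 0 by rewrite gt_eqF // l_gt0.
have D := is_diff_horo (s *: b) ls0.
exact: differentiable_continuous.
Qed.

Lemma form_u_dhoro (t : R) b v : f u (dhoro t b v) = 2^-1 * t ^- 2 * v.1.
Proof.
rewrite /dhoro !(symDr, symNr, symZr) fuu fuu' !form_u_from_coord.
by ring.
Qed.

Lemma form_dhoro (t : R) b v x : f u x = 0 -> f u' x = 0 ->
  f x (dhoro t b v) =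
  t^-1 * f x (from_coord e v.2) - t ^- 2 * v.1 * f x (from_coord e b).
Proof.
move=> ux u'x; rewrite /dhoro !(symDr, symNr, symZr).
rewrite (symC x u) (symC x u') ux u'x.
by ring.
Qed.

Section Frame.
Variables (n : nat) (y : nat -> 'rV[R]_d).
Hypothesis n_le_m : (n <= m)%N.
Hypothesis y0 : y 0 = u.
Hypothesis uy : forall k : 'I_n, f u (y k.+1) = 0.
Hypothesis u'y : forall k : 'I_n, f u' (y k.+1) = 0.
Hypothesis ye : forall (k : 'I_n) (i : 'I_m), (n <= i)%N ->
  f (y k.+1) e`_i.+1 = 0.

Lemma form_frame_coord (k : 'I_n) (b : 'rV[R]_m) :
  f (y k.+1) (from_coord e b) =
  \sum_(i < n) f (y k.+1) e`_i.+1 * b 0 (widen_ord n_le_m i).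
Proof.
rewrite form_from_coordr (bigID (fun i : 'I_m => (i < n)%N)) /=.
rewrite [X in _ + X]big1 ?addr0 => [|i]; last first.
  by rewrite -leqNgt => ni; rewrite ye // mulr0.
by rewrite (big_ord_narrow n_le_m); apply: eq_bigr => i _; rewrite mulrC.
Qed.

Lemma form_frame_horo_trunc (t : R) (b : 'rV[R]_m) (i : 'I_n.+1) :
  f (y i) (Z (t, trunc_coord n.+1 b)) = f (y i) (Z (t, b)).
Proof.
rewrite /Z /horo !(symDr, symZr) /=.
case: (unliftP ord0 i) => [k|] ->; last first.
  by rewrite /= y0 fuu !mulr0 !form_u_from_coord.
rewrite lift0 !(symC (y k.+1) u) !(symC (y k.+1) u') uy u'y !mulr0.
congr (_ + _ * _ + _); rewrite !form_frame_coord.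
by apply: eq_bigr => j _; rewrite mxE /= ltn_ord.
Qed.

Lemma dcoordS (i : 'I_m) (v : R * 'rV[R]_m) : dcoord i.+1 v = v.2 0 i.
Proof. by rewrite /dcoord /= (nth_map i) ?size_enum_ord // nth_ord_enum. Qed.

Lemma det_frame_dhoro (t : R) (b : 'rV[R]_m) (eta : 'I_n.+1 -> R * 'rV[R]_m) :
  \det (\matrix_(i < n.+1, j < n.+1) f (y i) (dhoro t b (eta j))) =
  2^-1 * t ^- n.+2 * \det (\matrix_(i < n, j < n) f (y i.+1) e`_j.+1)
  * wedge (fun i : 'I_n.+1 => @dcoord R m i) eta.
Proof.
pose C := \matrix_(i < n, j < n) f (y i.+1) e`_j.+1.
pose c : 'cV_n := \col_k (- t ^- 2 * f (y k.+1) (from_coord e b)).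
pose N : 'M[R]_(1 + n) := block_mx (2^-1 * t ^- 2)%:M 0 c (t^-1 *: C).
have dN : \det N = 2^-1 * t ^- n.+2 * \det C.
  rewrite det_lblock det_scalar1 detZ mulrA; congr (_ * _).
  by rewrite -mulrA exprVn -invfM -exprD.
rewrite (_ : \matrix_(_, _) _ =
    N *m \matrix_(i < n.+1, j < n.+1) dcoord i (eta j)); last first.
  apply/matrixP => i j; rewrite !mxE (@big_split_ord _ _ _ 1 n) big_ord1 /=.
  case: (@split_ordP 1 n i) => k ->.
    rewrite block_mxEul big1 ?addr0 => [|l _]; last first.
      by rewrite block_mxEur mxE mul0r.
    by rewrite !mxE (ord1 k) mulr1n /= y0 form_u_dhoro.
  rewrite block_mxEdl !mxE /= add1n form_dhoro // [LHS]addrC; congr (_ + _).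
    by rewrite /dcoord /=; ring.
  rewrite form_frame_coord mulr_sumr; apply: eq_bigr => l _.
  rewrite block_mxEdr !mxE /= add1n -mulrA; congr (_ * (_ * _)).
  by rewrite -(dcoordS (widen_ord n_le_m l)).
by rewrite det_mulmx dN.
Qed.

End Frame.
End Coordinates.
End Horospherical.

(* c is the determinant of w_1, ..., w_(n-1) against the orthonormal basis
   e_2, ..., e_n of U': det g depends on the choice of the w_i while
   db_1, ..., db_(n-1) only depend on the e_i. The formula without c holds when
   the two bases have the same oriented volume, in particular for
   w_i = e_(i+1). *)
Theorem lemma6p4 (R : realType) (V : vectType rat) (B : {symmetric V})
  (p n : nat) (o : (p.+1).-tuple V) (u0 u0' : V) (w : p.-1.-tuple V)
  (e : p.-tuple (realification R V)) (X : n.-tuple (realification R V))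
  (g : 'M[R]_n) :
  let f : {symmetric realification R V} := realform R B in
  let u := toR R u0 in
  let u' := toR R u0' in
  let Z0 := u + u' in
  let U := <<X>>%VS in
  let W := orthov f <<[:: u; u']>>%VS in
  let U' := (U :&: W)%VS in
  let U'' := (W :&: orthov f U')%VS in
  let Z (x : R * 'rV[R]_p.-1) := horo f u u' x.1 (from_coord e x.2) in
  (1 <= n <= p)%N ->
  \dim {:V} = p.+1 ->
  has_signature f p 1 ->
  basis_of fullv o ->
  Witt_basis B o u0 w u0' ->
  e`_0 = u - u' ->
  orthonormal f e ->
  basis_of (orthov f <[Z0]>%VS) e ->
  <<behead (take n e)>>%VS = U' ->
  <<drop n e>>%VS = U'' ->
  free X ->
  U = <<[seq toR R v | v <- take n (u0 :: w)]>>%VS ->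
  (forall j : 'I_n, X`_j = \sum_(i < n) g i j *: toR R (u0 :: w)`_i) ->
  forall (t : R) (b : 'rV[R]_p.-1) (eta : 'I_n -> R * 'rV[R]_p.-1),
  0 < t ->
  let lhs := pullback Z (phi f Z0 X) (t, b) eta in
  let rhs := 2 `^ (n%:R / 2) * (2^-1 * \det g)
    * expR (- pi * \tr (\matrix_(i < n, j < n)
                          majorant f (Z (t, trunc_coord n b)) X`_i X`_j))
    * t ^- n.+1 * wedge (fun i : 'I_n => @dcoord R p.-1 i) eta in
  let c := \det (\matrix_(i < n.-1, j < n.-1) f (toR R w`_i) e`_j.+1) in
  lhs = c * rhs /\ (c = 1 -> lhs = rhs).
Proof.
case: n X g => [|n] X g; first by move=> ? ? ? ? ? ? ? ? ? /andP[].
case: p o w e => [|m] o w e; first by move=> ? ? ? ? ? ? ? ? ? /andP[].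
move=> f u u' Z0 U W U' U'' Z /andP[_ n_le_m] _ _ _.
move=> [_ _ uu u'u' uu' Wp _] e0 e_on e_bas spanU' spanU'' _ spanU Xg.
move=> t b eta t_gt0 lhs rhs c.
have {}n_le_m : (n <= m)%N := n_le_m.
have fE v1 v2 : f (toR R v1) (toR R v2) = ratr (B v1 v2)
  := realform_toR R B v1 v2.
have {}uu : f u u = 0 by rewrite fE uu rmorph0.
have {}u'u' : f u' u' = 0 by rewrite fE u'u' rmorph0.
have {}uu' : f u u' = - 2^-1 by rewrite fE uu' rmorphN fmorphV rmorph_nat.
have fe (i j : 'I_m) : f e`_i.+1 e`_j.+1 = (i == j)%:R.
  by rewrite (orthonormal_nth e_on) ?size_tuple ?ltnS.
have eZ0 (i : 'I_m) : f e`_i.+1 Z0 = 0.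
  apply/eqP; rewrite -mem_orthov1; apply: (basis_mem e_bas).
  by rewrite mem_nth // size_tuple ltnS.
have ee0 (i : 'I_m) : f e`_i.+1 (u - u') = 0.
  by rewrite -e0 (orthonormal_nth e_on) ?size_tuple ?ltnS.
have ue (i : 'I_m) : f u e`_i.+1 = 0.
  have : f e`_i.+1 (Z0 + (u - u')) = 2 * f u e`_i.+1.
    by rewrite /Z0 !(symDr, symNr) !(symC f e`_i.+1); ring.
  rewrite symDr eZ0 ee0 addr0 => /esym/eqP.
  by rewrite mulf_eq0 pnatr_eq0 => /eqP.
have u'e (i : 'I_m) : f u' e`_i.+1 = 0.
  have h := eZ0 i.
  by rewrite /Z0 symDr !(symC f e`_i.+1) ue add0r in h.
pose y k := toR R (u0 :: w)`_k.
have w_perp k x : (k < n)%N -> x \in [:: u0; u0'] -> B w`_k x = 0.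
  move=> kn x_in.
  have /(basis_mem Wp)/mem_orthovP : w`_k \in (w : seq V).
    by rewrite mem_nth // size_tuple (leq_trans kn).
  by apply; rewrite memv_span.
have uy (k : 'I_n) : f u (y k.+1) = 0.
  by rewrite symC fE /= w_perp ?rmorph0 ?inE ?eqxx.
have u'y (k : 'I_n) : f u' (y k.+1) = 0.
  by rewrite symC fE /= w_perp ?rmorph0 ?inE ?eqxx ?orbT.
have yU' (k : 'I_n) : y k.+1 \in U'.
  rewrite /U' memv_cap /W spanU; apply/andP; split.
    have sz : size (take n.+1 (u0 :: w)) = n.+1.
      by rewrite size_takel //= size_tuple.
    have -> : y k.+1 = [seq toR R v | v <- take n.+1 (u0 :: w)]`_k.+1.
      by rewrite (nth_map 0) ?sz ?ltnS // nth_take ?ltnS.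
    by rewrite memv_span // mem_nth // size_map sz ltnS.
  rewrite memvE span_cons span_seq1 orthovD !orthov11.
  by rewrite !(symC f (y _)) uy u'y eqxx.
have ye (k : 'I_n) (i : 'I_m) : (n <= i)%N -> f (y k.+1) e`_i.+1 = 0.
  move=> ni; rewrite symC.
  have : e`_i.+1 \in U''.
    rewrite -spanU'' memv_span //.
    have -> : e`_i.+1 = (drop n.+1 e)`_(i - n).
      by rewrite nth_drop addSn subnKC.
    rewrite mem_nth // size_drop size_tuple subSS ltn_sub2r //.
    exact: leq_ltn_trans ni (ltn_ord i).
  by rewrite /U'' memv_cap => /andP[_ /mem_orthovP]; apply; exact: yU'.
suff E : lhs = c * rhs by split=> // c1; rewrite E c1 mul1r.
have t0 : t != 0 by rewrite gt_eqF.
have DZ := is_diff_horo u u' fe b t0.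
rewrite /lhs /pullback diff_val /phi asboolT; last first.
  split; first exact: horo_hyperboloid.
  by move=> j; exact: tangent_dhoro.
have XE (i : 'I_n.+1) z : f X`_i z = \sum_(k < n.+1) g k i * f (y k) z.
  by rewrite symC Xg sym_sumr; apply: eq_bigr => k _; rewrite symZr symC.
have ZZ b' : f (Z (t, b')) (Z (t, b')) = -1.
  apply: horo_norm => //; first exact: form_u_from_coord.
  exact: form_u'_from_coord.
have -> : \matrix_(i < n.+1, j < n.+1) f X`_i (dhoro f u u' e t b (eta j)) =
    g^T *m \matrix_(i < n.+1, j < n.+1) f (y i) (dhoro f u u' e t b (eta j)).
  apply/matrixP => i j; rewrite !mxE XE.
  by apply: eq_bigr => k _; rewrite !mxE.
rewrite det_mulmx det_tr.
rewrite (det_frame_dhoro uu uu' ue n_le_m (erefl u) uy u'y ye).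
have -> : \matrix_(i < n.+1, j < n.+1) majorant f (Z (t, b)) X`_i X`_j =
  \matrix_(i < n.+1, j < n.+1)
    majorant f (Z (t, trunc_coord n.+1 b)) X`_i X`_j.
  have XZ (i : 'I_n.+1) :
    f X`_i (Z (t, trunc_coord n.+1 b)) = f X`_i (Z (t, b)).
    rewrite !XE; apply: eq_bigr => k _.
    congr (_ * _).
    exact: (form_frame_horo_trunc uu ue n_le_m (erefl u) uy u'y ye).
  by apply/matrixP => i j; rewrite !mxE !majorantE // !XZ.
rewrite /rhs /c; ring.
Qed.
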